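(* Let $P(x) \in \mathbb{Z}[x]$ be a cubic polynomial (i.e. of degree exactly $3$). Then $P(x) \in \mathcal{P}$; that is, there are infinitely many positive integers $n$ such that $P(n) \mid n!$.
   Context: $\mathcal{P}$ denotes the set of polynomials $P(x)$ with integer coefficients such that $P(n) \mid n!$ for infinitely many positive integers $n$ (divisibility in $\mathbb{Z}$). *)

(* Defs.v *)
From mathcomp Require Import all_boot all_order all_algebra.

Set Implicit Arguments.
Unset Strict Implicit.
Unset Printing Implicit Defensive.

Local Open Scope ring_scope.

(* Infinitude of the set of positive n is expressed as unboundedness in nat;
   [N < n] forces n to be positive. A zero value of P divides no factorial. *)
Definition calP (P : {poly int}) : Prop :=
  forall N : nat, exists2 n : nat, (N < n)%N & (P.[n%:Z] %| (n`!)%:Z)%Z.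

(* Main.v *)
Require Import Defs.
From mathcomp Require Import all_boot all_order all_algebra.
From mathcomp Require Import ring lra.

(** The proof looks for a substitution under which P splits into factors that
    are no larger than the argument itself.

    Criterion ([calP_of_factorization]). Suppose that over the rationals
    P (G t) = c * F_1 t * ... * F_r t with 1 <= deg F_i <= deg G, and that G takes an
    integer value at some rational t0. For a suitable integer L the value
    G (t0 + L k) is an integer for every integer k, and one may move t0 along
    this progression to a point t1 at which all the F_i are huge. Then
    F_i (t1 + L' k) / F_i t1 is, for a suitable L', an integer that is a tiny
    fraction of n = G (t1 + L' k), and P n is the constant P (G t1) times
    the product of these integers. Positive integers with sum at most n have a
    product dividing n!, so P n divides n!.

    The splitting ([cubic_splitting_map]). Let e run over the three roots of
    e^3 + c2 e^2 + c1 e + c0 and put g = - c1 / 2 - c0 / e. Then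
    g^2 = c1^2 / 4 - c0 c2 - c0 e is an affine function of e with coefficients
    that do not depend on the root. With 2 m the sum of the three g^2, the number
    (g (g^2 - m))^2 is again an affine function of g^2, hence of e. So there is
    one affine function A, nonconstant in the cases below, with
    A e = (g (g^2 - m))^2 for each root, and the substitution
    e := A^-1 ((t (t^2 - m))^2), of degree 6 in t, turns the cubic into a constant multiple of the product over the roots of
    (t (t^2 - m))^2 - (g (g^2 - m))^2, where each term is
    (t - g) (t + g) (t^2 + g t + g^2 - m) (t^2 - g t + g^2 - m).
    Collecting the conjugates gives rational factors of degrees 3, 3, 6, 6.

    Integrality. There remains to find a rational t for which the substitution
    gives an integer n. Here the freedom is the centre u / v at which P is
    expanded: the splitting is applied to the cubic in the distance to u / v, and
    n equals an integer n0, quadratic in t, minus a multiple of P n0 divided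
    by taylor1 * taylorE, two integers attached to the centre. The prime
    factors of v absorb all the bad primes, and a suitable residue of t handles
    taylorE. For taylor1, proportional to the derivative of P at the centre,
    P must have a root modulo it; this is arranged by choosing u / v as the
    solution of a linear equation ([exists_center]). All moduli are then coprime
    and the Chinese remainder theorem gives t ([exists_residue]).

    When the discriminant vanishes P has a rational double root, so it splits into
    linear factors and the criterion applies with G t = t. *)

Set Implicit Arguments.
Unset Strict Implicit.
Unset Printing Implicit Defensive.
Import Order.TTheory GRing.Theory Num.Theory.
Local Open Scope ring_scope.

(** * Divisors of factorials and values of rational polynomials *)

(** The product divides the product of the factorials of the entries, and multinomial
    coefficients are integers. *)
Lemma prod_dvdn_fact (s : seq nat) (n : nat) :
  all (leq 1) s -> (sumn s <= n)%N -> (\prod_(m <- s) m %| n`!)%N.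
Proof.
elim: s n => [|a s IHs] n /=; first by rewrite big_nil dvd1n.
case/andP=> a_gt0 s_gt0 le_n; rewrite big_cons.
have le_an : (a <= n)%N by apply: leq_trans le_n; apply: leq_addr.
rewrite -(bin_fact le_an); apply/dvdn_mull/dvdn_mul; first by rewrite dvdn_fact // a_gt0 /=.
by apply: IHs => //; rewrite leq_subRL.
Qed.

(** A positive lower bound, rather than mere positivity, is what makes the induction
    on p go through. *)
Lemma poly_eventually_ge (p : {poly rat}) : 0 < lead_coef p ->
  exists2 d : rat, 0 < d & exists T : rat, forall t, T <= t -> d <= p.[t].
Proof.
elim/poly_ind: p => [|p c IHp]; first by rewrite lead_coef0 ltxx.
have [-> | p_neq0] := eqVneq p 0.
  rewrite mul0r add0r lead_coefC => c_gt0; exists c => //.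
  by exists 0 => t _; rewrite hornerC.
rewrite lead_coefDl ?lead_coefMX => [/IHp [d d_gt0 [T dP]]|]; last first.
  by rewrite size_mulX // ltnS (leq_trans (size_polyC_leq1 c)) // size_poly_gt0.
exists d => //; exists (Num.max T (1 + `|c| / d)) => t.
rewrite ge_max => /andP[/dP le_d le_t]; rewrite hornerD hornerMX hornerC.
have : `|c| + d <= d * t.
  by move: le_t; rewrite -(ler_pM2l d_gt0) mulrDr mulr1 mulrCA divff ?gt_eqF // mulr1 addrC.
have t_ge0 : 0 <= t by apply: le_trans le_t; rewrite addr_ge0 // divr_ge0 // ltW.
have := ler_wpM2r t_ge0 le_d; have := ler_norm (- c); rewrite normrN; lra.
Qed.

Lemma poly_eventually_gt (p : {poly rat}) (b : rat) :
  (1 < size p)%N -> 0 < lead_coef p -> exists T : rat, forall t, T <= t -> b < p.[t].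
Proof.
move=> szp lp.
have [|d d_gt0 [T dP]] := @poly_eventually_ge (p - b%:P).
  by rewrite lead_coefDl // -polyCN (leq_ltn_trans (size_polyC_leq1 _)).
exists T => t /dP; rewrite hornerD hornerN hornerC; lra.
Qed.

Lemma poly_eventually_le (p q : {poly rat}) (K : rat) :
    (size p <= size q)%N -> p`_(size q).-1 < K * lead_coef q ->
  exists T : rat, forall t, T <= t -> p.[t] <= K * q.[t].
Proof.
move=> le_pq lt_pq.
have lK : 0 < (K *: q - p)`_(size q).-1 by rewrite coefB coefZ -lead_coefE subr_gt0.
have szK : size (K *: q - p) = size q.
  apply/eqP; rewrite eqn_leq; apply/andP; split.
    by rewrite (leq_trans (size_polyD _ _)) // geq_max size_polyN le_pq size_scale_leq.
  rewrite -ltnS; case: (size q) lK => // m /= lK.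
  by rewrite ltnS ltnNge; apply: contraL lK => ?; rewrite nth_default // ltxx.
have [|d d_gt0 [T dP]] := @poly_eventually_ge (K *: q - p); first by rewrite lead_coefE szK.
by exists T => t /dP; rewrite hornerD hornerN hornerZ; lra.
Qed.

(** Dividing p - p.[t] by 'X - t%:P shows that the difference is (L * k) times a
    value of a polynomial whose denominators are cleared by L. *)
Lemma poly_int_period (p : {poly rat}) (t : rat) :
  exists2 L : int, 0 < L &
    forall k : int, p.[t + (L * k)%:~R] - p.[t] \is a Num.int.
Proof.
have /factor_theorem[q Dq] : root (p - p.[t]%:P) t by rewrite rootE !hornerE subrr.
have [r [a a_neq0 Dr]] := rat_poly_scale (q \Po ('X + t%:P)).
exists `|a|; first by rewrite normr_gt0.
move=> k; have -> : `|a| * k = a * (Num.sg a * k) by rewrite mulrA (mulrC a) -normrEsg.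
move: (_ * k) => {}k.
have -> : p.[t + (a * k)%:~R] - p.[t] = (p - p.[t]%:P).[t + (a * k)%:~R].
  by rewrite !hornerE.
rewrite Dq hornerM !hornerE addrAC subrr add0r.
have -> : q.[t + (a * k)%:~R] = (q \Po ('X + t%:P)).[(a * k)%:~R].
  by rewrite horner_comp !hornerE addrC.
rewrite Dr hornerZ mulrAC intrM mulKf ?intr_eq0 //.
by rewrite -intrM horner_map rpredM ?intr_int.
Qed.

Lemma seq_poly_int_period (ps : seq {poly rat}) (t : rat) :
  exists2 L : int, 0 < L &
    forall p, p \in ps -> forall k : int, p.[t + (L * k)%:~R] - p.[t] \is a Num.int.
Proof.
elim: ps => [|p ps [L L_gt0 LP]]; first by exists 1.
have [M M_gt0 MP] := poly_int_period p t.
exists (L * M); first exact: mulr_gt0.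
move=> r; rewrite inE => /predU1P[-> k|/LP rP k]; last by rewrite -mulrA.
by rewrite (mulrC L) -mulrA.
Qed.

Lemma seq_eventually (T : eqType) (s : seq T) (Q : T -> rat -> Prop) :
  (forall x, x \in s -> exists b, forall t, b <= t -> Q x t) ->
  exists b, forall t, b <= t -> forall x, x \in s -> Q x t.
Proof.
elim: s => [|x s IHs] sQ; first by exists 0.
have [|b bP] := IHs; first by move=> y ys; apply: sQ; rewrite inE ys orbT.
have [|b' b'P] := sQ x; first by rewrite mem_head.
exists (Num.max b b') => t; rewrite ge_max => /andP[/bP tP /b'P xP] y.
by rewrite inE => /predU1P[->|/tP].
Qed.

Lemma int_progression_large (t L b : rat) : 0 < L ->
  exists k : nat, b <= t + L * k%:R.
Proof.
move=> L_gt0; exists (Num.bound (`|b - t| / L)).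
have := archi_boundP (divr_ge0 (normr_ge0 (b - t)) (ltW L_gt0)).
rewrite ltr_pdivrMr // mulrC; have := ler_norm (b - t); lra.
Qed.

(** * A factorization criterion *)

(** The ratios F.[t] / F.[t1] are the integral cofactors: along a suitable progression they
    stay congruent to their value 1 at t1. The choice of t1 makes them small against
    n = G.[t], and c is hidden in the constant P.[n1]. *)
Theorem calP_of_factorization (P : {poly int}) (G : {poly rat}) (Fs : seq {poly rat})
    (c t0 : rat) :
    c != 0 -> (1 < size G)%N -> 0 < lead_coef G ->
    (forall F, F \in Fs -> [/\ (1 < size F)%N, (size F <= size G)%N & 0 < lead_coef F]) ->
    (forall t, (map_poly intr P).[G.[t]] = c * \prod_(F <- Fs) F.[t]) ->
    G.[t0] \is a Num.int ->
  calP P.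
Proof.
move=> c_neq0 szG lG FsP splitP Gt0_int N.
pose r := size Fs.
(* With F.[t1] > 2 * r.+1 * K and F.[t] <= K * G.[t], each ratio F.[t] / F.[t1] is at most
   G.[t] / (2 * r.+1), so that together they use up at most half of n = G.[t]. *)
have [K K_gt0 KP] : exists2 K : rat, 0 < K &
    forall F, F \in Fs -> F`_(size G).-1 < K * lead_coef G.
  have [|K0 K0P] := @seq_eventually _ Fs (fun F K => F`_(size G).-1 < K * lead_coef G).
    move=> F _; exists (F`_(size G).-1 / lead_coef G + 1) => K.
    by rewrite -(ler_pM2r lG) mulrDl mulfVK ?gt_eqF //; lra.
  by exists (Num.max K0 1) => [|F]; [rewrite lt_max ltr01 orbT | apply: K0P; rewrite le_max lexx].
have [|T1 T1P] := @seq_eventually _ Fs (fun F t => F.[t] <= K * G.[t]).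
  by move=> F Fs_F; apply: poly_eventually_le; [case: (FsP F Fs_F) | apply: KP].
have [|T2 T2P] := @seq_eventually _ Fs (fun F t => 2 * r.+1%:R * K < F.[t]).
  by move=> F /FsP[szF _ lF]; apply: poly_eventually_gt.
have rK_gt0 : 0 < 2 * r.+1%:R * K by rewrite !mulr_gt0 ?ltr0n.
have [L L_gt0 LP] := poly_int_period G t0.
have [k0 le_T2] : exists k : nat, T2 <= t0 + L%:~R * k%:R.
  by apply: int_progression_large; rewrite ltr0z.
set t1 := _ + _ in le_T2.
have [n1 Dn1] : exists n1 : int, G.[t1] = n1%:~R.
  apply/intrP; rewrite -(subrK G.[t0] G.[t1]) rpredD //.
  by have := LP k0; rewrite intrM.
have F1 := T2P _ le_T2.
have F1_gt0 F : F \in Fs -> 0 < F.[t1] by move/F1; apply: lt_trans.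
have [L' L'_gt0 {}LP] := seq_poly_int_period (G :: [seq F.[t1]^-1 *: F | F <- Fs]) t1.
have [T3 T3P] := poly_eventually_gt (Num.max N%:R (2 * `|P.[n1]|%:~R)) szG lG.
have [k le_T] : exists k : nat, Num.max T1 T3 <= t1 + L'%:~R * k%:R.
  by apply: int_progression_large; rewrite ltr0z.
set t := _ + _ in le_T.
move: le_T; rewrite ge_max => /andP[/T1P {}T1P /T3P]; rewrite gt_max => /andP[lt_N lt_P].
have [n Dn] : exists n : nat, G.[t] = n%:R.
  apply/natrP; rewrite natrEint (le_trans _ (ltW lt_N)) ?ler0n // andbT.
  rewrite -(subrK G.[t1] G.[t]) rpredD ?Dn1 ?intr_int // -Dn1.
  by have := LP G (mem_head _ _) k; rewrite intrM.
pose h F := Num.truncn (F.[t] / F.[t1]).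
have hP F : F \in Fs -> (h F)%:R = F.[t] / F.[t1] /\ (0 < h F)%N.
  move=> Fs_F; have F1_neq0 : F.[t1] != 0 by rewrite gt_eqF ?F1_gt0.
  have F_gt0 : 0 < F.[t] / F.[t1].
    rewrite divr_gt0 ?F1_gt0 // (lt_trans rK_gt0) // T2P // (le_trans le_T2) //.
    by rewrite lerDl mulr_ge0 ?ler0n // ltW // ltr0z.
  have Dh : (h F)%:R = F.[t] / F.[t1].
    rewrite truncnK // natrEint (ltW F_gt0) andbT -(subrK 1 (_ / _)) rpredD ?rpred1 //.
    have := LP (F.[t1]^-1 *: F) _ k.
    rewrite inE (map_f (fun F0 => F0.[t1]^-1 *: F0)) ?orbT // => /(_ isT).
    by rewrite !hornerZ mulVf // intrM mulrC.
  by rewrite Dh -(ltr0n rat) Dh.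
have DP : P.[n%:Z] = P.[n1] * (\prod_(F <- Fs) h F)%:Z.
  apply: (@intr_inj rat); rewrite intrM -!horner_map /= -Dn1 -[n%:Z%:~R]Dn !splitP.
  rewrite -mulrA; congr (_ * _); rewrite -[_%:Z%:~R]/(_%:R) natr_prod -big_split /=.
  rewrite !big_seq; apply: eq_bigr => F Fs_F.
  by have [-> _] := hP F Fs_F; rewrite mulrC divfK // gt_eqF ?F1_gt0.
have P1_neq0 : P.[n1] != 0.
  rewrite -(intr_eq0 rat) -horner_map /= -Dn1 splitP mulf_neq0 // prodf_seq_neq0.
  by apply/allP=> F /F1_gt0 F_gt0; rewrite gt_eqF.
exists n; first by rewrite -(ltr_nat rat) -Dn.
have -> : (P.[n%:Z] %| (n`!)%:Z)%Z = (\prod_(m <- `|P.[n1]|%N :: map h Fs) m %| n`!)%N.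
  by rewrite dvdzE DP abszM big_cons big_map.
apply: prod_dvdn_fact => /=.
  by rewrite absz_gt0 P1_neq0 /=; apply/allP=> _ /mapP[F /hP[_ F_gt0] ->].
have le_h F : F \in Fs -> (h F)%:R <= n%:R / (2 * r.+1%:R) :> rat.
  move=> Fs_F; have [-> _] := hP F Fs_F.
  rewrite ler_pdivrMr ?F1_gt0 // (le_trans (T1P F Fs_F)) // Dn.
  rewrite mulrAC ler_pdivlMr ?mulr_gt0 ?ltr0n // mulrC mulrA mulrC ler_wpM2l ?ler0n //.
  exact/ltW/F1.
rewrite -(ler_nat rat) natrD sumnE big_map natr_sum.
have : \sum_(F <- Fs) (h F)%:R <= n%:R / 2 :> rat.
  rewrite big_seq (le_trans (ler_sum _ le_h)) // -big_seq.
  rewrite big_const_seq count_predT iter_addr_0 -[_ *+ size Fs]mulr_natr.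
  rewrite invfM [n%:R * _]mulrA -(mulrA (n%:R / 2)) ler_piMr ?divr_ge0 ?ler0n //.
  by rewrite mulrC ler_pdivrMr ?ltr0n // mul1r ler_nat.
by rewrite -Dn natr_absz; move: lt_P; lra.
Qed.

(** * Splitting a cubic by a sextic substitution *)

Lemma Poly_size_lead (s : seq rat) : last 0 s != 0 ->
  size (Poly s) = size s /\ lead_coef (Poly s) = last 0 s.
Proof. by move=> /PolyK sP; rewrite lead_coefE sP nth_last. Qed.

(** The polynomial with roots g, where the coefficients are written so that the sum
    of the roots is - 2 * E. *)
Definition cubic_factor (E B C : rat) : {poly rat} := Poly [:: C; B; 2 * E; 1].

(** The product over the roots g of cubic_factor E B C of 'X^2 + g * 'X + g ^+ 2 - m;
    here 2 * m is the sum of the squares of the roots. *)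
Definition sextic_factor (E B C : rat) : {poly rat} :=
  let m := 2 * E ^+ 2 - B in
  Poly [:: m ^+ 3 + 4 * E * C * m - B ^+ 2 * m + C ^+ 2;
           - 2 * E * m ^+ 2 - 3 * C * m + 2 * E * B * m - B * C;
           - m ^+ 2 - B * m - 2 * E * C + B ^+ 2;
           4 * E * m + 2 * C - 2 * E * B;
           B - m; - 2 * E; 1].

(** Both sides are the product over the roots g of cubic_factor E B C of
    (t * (t ^+ 2 - m)) ^+ 2 - (g * (g ^+ 2 - m)) ^+ 2. On the left
    (g * (g ^+ 2 - m)) ^+ 2 has been replaced by D * g ^+ 2 + C ^+ 2, an equality which
    holds because g ^+ 2 is a root of x ^+ 3 - 2 * m * x ^+ 2 + S * x - C ^+ 2 and
    D = m ^+ 2 - S. *)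
Lemma splitting_identity (E B C t : rat) :
  let m := 2 * E ^+ 2 - B in
  let S := B ^+ 2 - 4 * E * C in
  let D := 4 * E * (E ^+ 3 - E * B + C) in
  let y := (t * (t ^+ 2 - m)) ^+ 2 - C ^+ 2 in
  y ^+ 3 - 2 * m * D * y ^+ 2 + S * D ^+ 2 * y - C ^+ 2 * D ^+ 3 =
  (cubic_factor E B C).[t] * (cubic_factor (- E) B (- C)).[t] *
    (sextic_factor E B C).[t] * (sextic_factor (- E) B (- C)).[t].
Proof. by rewrite /cubic_factor /sextic_factor !horner_Poly /=; ring. Qed.

Definition cubic (R : comNzRingType) (c2 c1 c0 e : R) : R :=
  e ^+ 3 + c2 * e ^+ 2 + c1 * e + c0.

(** This is 64 * c0 ^+ 2 times the value at - c1 / (4 * c0) of the reversed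
    cubic c0 * x ^+ 3 + c1 * x ^+ 2 + c2 * x + 1. *)
Definition quarter_reverse (R : comNzRingType) (c2 c1 c0 : R) : R :=
  3 * c1 ^+ 3 - 16 * c0 * c1 * c2 + 64 * c0 ^+ 2.

(** For a root e of the cubic and g = - c1 / 2 - c0 / e, this map sends both g and - g
    to e. With m, C and D as in the splitting identity, it solves for e in
    g ^+ 2 = c1 ^+ 2 / 4 - c0 * c2 - c0 * e and
    (g * (g ^+ 2 - m)) ^+ 2 = D * g ^+ 2 + C ^+ 2. *)
Definition splitting_map (c2 c1 c0 t : rat) : rat :=
  let D := - c1 * quarter_reverse c2 c1 c0 / 64 in
  let C := - c1 ^+ 3 / 8 + c0 * c1 * c2 / 2 - c0 ^+ 2 in
  let m := 3 * c1 ^+ 2 / 8 - c0 * c2 in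
  (c1 ^+ 2 / 4 - c0 * c2 - ((t * (t ^+ 2 - m)) ^+ 2 - C ^+ 2) / D) / c0.

Lemma scaled_neq0 (x y : rat) : x != 0 -> y != 0 -> - x * y / 64 != 0.
Proof.
move=> x_neq0 y_neq0; apply: mulf_neq0; last by rewrite invr_eq0 pnatr_eq0.
by rewrite mulf_neq0 ?oppr_eq0.
Qed.

Lemma cubic_splitting_map (c2 c1 c0 t : rat) :
    c0 != 0 -> c1 != 0 -> quarter_reverse c2 c1 c0 != 0 ->
  let D := - c1 * quarter_reverse c2 c1 c0 / 64 in
  let E := c1 / 4 in
  let B := c0 * c2 - c1 ^+ 2 / 4 in
  let C := - c1 ^+ 3 / 8 + c0 * c1 * c2 / 2 - c0 ^+ 2 in
  cubic c2 c1 c0 (splitting_map c2 c1 c0 t) =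
  - (c0 * D) ^- 3 * ((cubic_factor E B C).[t] * (cubic_factor (- E) B (- C)).[t] *
    (sextic_factor E B C).[t] * (sextic_factor (- E) B (- C)).[t]).
Proof.
move=> c0_neq0 c1_neq0 Eh_neq0 D E B C; rewrite -splitting_identity.
have D_neq0 : D != 0 by apply: scaled_neq0.
have -> : 4 * E * (E ^+ 3 - E * B + C) = D by rewrite /D /E /B /C /quarter_reverse; field.
have -> : 2 * E ^+ 2 - B = 3 * c1 ^+ 2 / 8 - c0 * c2 by rewrite /E /B; field.
rewrite /splitting_map -/D -/C; set y := (_ ^+ 2 - C ^+ 2).
by rewrite /cubic /B /E /C; field; rewrite c0_neq0 D_neq0.
Qed.

(** At this value of t the number e is the one with t ^+ 2 = c1 ^+ 2 / 4 - c0 * c2 - c0 * e.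
    The formula isolates the part of the map that can have denominators: a multiple of
    the value of the cubic at e. *)
Lemma splitting_map_at (c2 c1 c0 s : rat) :
    c0 != 0 -> c1 != 0 -> quarter_reverse c2 c1 c0 != 0 ->
  let e := - (c0 * s ^+ 2 + c1 * s + c2) in
  splitting_map c2 c1 c0 (- c0 * s - c1 / 2) =
  e - 64 * c0 ^+ 2 * cubic c2 c1 c0 e / (c1 * quarter_reverse c2 c1 c0).
Proof.
move=> c0_neq0 c1_neq0 Eh_neq0 e; rewrite /e /splitting_map /cubic /quarter_reverse.
rewrite /quarter_reverse in Eh_neq0.
by field; rewrite c0_neq0 c1_neq0 Eh_neq0.
Qed.

(** The positivity of c0, c1 and quarter_reverse makes the leading coefficient of the
    substitution positive, so that the arguments n tend to + infinity. The integrality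
    hypothesis concerns the value of the substitution at - c0 * s - c1 / 2. *)
Theorem calP_of_cubic_point (P : {poly int}) (k al be c2 c1 c0 s : rat) :
    k != 0 -> 0 < al -> 0 < c0 -> 0 < c1 -> 0 < quarter_reverse c2 c1 c0 ->
    (forall e, (map_poly intr P).[al * e + be] = k * cubic c2 c1 c0 e) ->
  let e := - (c0 * s ^+ 2 + c1 * s + c2) in
  al * (e - 64 * c0 ^+ 2 * cubic c2 c1 c0 e / (c1 * quarter_reverse c2 c1 c0)) + be
    \is a Num.int ->
  calP P.
Proof.
move=> k_neq0 al_gt0 c0_gt0 c1_gt0 Eh_gt0 cubicP e.
have [c0_neq0 c1_neq0 Eh_neq0] : [/\ c0 != 0, c1 != 0 & quarter_reverse c2 c1 c0 != 0].
  by rewrite !gt_eqF.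
rewrite /e -splitting_map_at // => int_s.
pose kap := 64 * al / (c0 * c1 * quarter_reverse c2 c1 c0).
have kap_gt0 : 0 < kap by apply: divr_gt0; [apply: mulr_gt0 | rewrite 2?mulr_gt0].
pose m := 3 * c1 ^+ 2 / 8 - c0 * c2.
pose gs := [:: al * splitting_map c2 c1 c0 0 + be; 0; kap * m ^+ 2; 0; - 2 * kap * m; 0; kap].
have GE t : (Poly gs).[t] = al * splitting_map c2 c1 c0 t + be.
  rewrite horner_Poly /gs /= /kap /splitting_map -/m; move: (_ - c0 ^+ 2) => C.
  move: (quarter_reverse c2 c1 c0) Eh_neq0 => Eh Eh_neq0.
  by field; rewrite c0_neq0 c1_neq0 Eh_neq0.
have [|szG lG] := @Poly_size_lead gs; first by rewrite gt_eqF.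
pose E := c1 / 4.
pose B := c0 * c2 - c1 ^+ 2 / 4.
pose C := - c1 ^+ 3 / 8 + c0 * c1 * c2 / 2 - c0 ^+ 2.
pose D := - c1 * quarter_reverse c2 c1 c0 / 64.
have cubicF E' C' :
    size (cubic_factor E' B C') = 4%N /\ lead_coef (cubic_factor E' B C') = 1.
  by apply: Poly_size_lead; rewrite oner_neq0.
have sexticF E' C' :
    size (sextic_factor E' B C') = 7%N /\ lead_coef (sextic_factor E' B C') = 1.
  by apply: Poly_size_lead; rewrite oner_neq0.
apply: (@calP_of_factorization P (Poly gs) [:: cubic_factor E B C; cubic_factor (- E) B (- C);
   sextic_factor E B C; sextic_factor (- E) B (- C)] (- k * (c0 * D) ^- 3)
   (- c0 * s - c1 / 2)).
- have := scaled_neq0 c1_neq0 Eh_neq0; rewrite -/D; move: D => D' D_neq0.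
  by rewrite mulf_neq0 ?oppr_eq0 ?invr_eq0 ?expf_neq0 ?mulf_neq0.
- by rewrite szG.
- by rewrite lG.
- move=> F; rewrite szG !inE => /or4P[] /eqP->;
    [have [-> ->] := cubicF E C | have [-> ->] := cubicF (- E) (- C)
    |have [-> ->] := sexticF E C | have [-> ->] := sexticF (- E) (- C)]; by split.
- move=> t; rewrite GE cubicP (cubic_splitting_map _ c0_neq0 c1_neq0 Eh_neq0) -/E -/B -/C -/D.
  rewrite 4!big_cons big_nil; move: (_ ^- 3) _.[t] _.[t] _.[t] _.[t] => x f1 f2 f3 f4.
  by ring.
- by rewrite GE.
Qed.

(** * The residue of the parameter *)

Lemma coprimez_addl (m n k : int) : coprimez m (n + m * k) = coprimez m n.
Proof. by rewrite /coprimez addrC mulrC gcdzMDl. Qed.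

Lemma coprimez_dvd (d m n : int) : (d %| m)%Z -> coprimez m n -> coprimez d n.
Proof. by case/dvdzP=> k ->; rewrite coprimezMl => /andP[]. Qed.

Lemma linear_congruence (m a b : int) : coprimez m a -> exists s, (m %| a * s + b)%Z.
Proof.
case/coprimezP=> [[x y] /= xy1]; exists (- b * y); apply/dvdzP; exists (b * x).
by rewrite -[X in _ + X]mulr1 -xy1; ring.
Qed.

Lemma crtz (m1 m2 s1 s2 : int) : coprimez m1 m2 ->
  exists s, (m1 %| s - s1)%Z /\ (m2 %| s - s2)%Z.
Proof.
move=> m12; exists (zchinese m1 m2 s1 s2); rewrite -!eqz_mod_dvd.
by split; apply/eqP; [apply: zchinese_modl | apply: zchinese_modr].
Qed.

Lemma linear_congruences (m1 m2 m3 a1 a2 a3 b1 b2 b3 : int) :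
    coprimez m1 m2 -> coprimez m1 m3 -> coprimez m2 m3 ->
    coprimez m1 a1 -> coprimez m2 a2 -> coprimez m3 a3 ->
  exists s, [/\ (m1 %| a1 * s + b1)%Z, (m2 %| a2 * s + b2)%Z & (m3 %| a3 * s + b3)%Z].
Proof.
move=> m12 m13 m23 /(@linear_congruence _ _ b1)[s1 s1P] /(@linear_congruence _ _ b2)[s2 s2P].
move=> /(@linear_congruence _ _ b3)[s3 s3P].
have [s4 [s41 s42]] := crtz s1 s2 m12.
have [|s [s_4 s_3]] := @crtz (m1 * m2) m3 s4 s3; first by rewrite coprimezMl m13.
have shift m a b x y : (m %| a * x + b -> m %| y - x -> m %| a * y + b)%Z.
  move=> mx myx; rewrite (_ : _ + b = a * x + b + a * (y - x)); last by ring.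
  by rewrite rpredD // dvdz_mull.
exists s; split; last exact: shift s3P s_3.
  apply: shift s1P _; rewrite -(subrKA s4) rpredD //.
  by apply: dvdz_trans s_4; apply: dvdz_mulr.
apply: shift s2P _; rewrite -(subrKA s4) rpredD //.
by apply: dvdz_trans s_4; apply: dvdz_mull.
Qed.

(** The Taylor expansion of X ^+ 3 + 3 * p * X + q at u / v, with the
    denominators cleared, is e ^+ 3 + 3 * u * e ^+ 2 + 3 * taylor1 * e + taylor0. *)
Definition taylor0 (p q u v : int) : int := u ^+ 3 + 3 * p * u * v ^+ 2 + q * v ^+ 3.

Definition taylor1 (p u v : int) : int := u ^+ 2 + p * v ^+ 2.

Definition taylorE (p q u v : int) : int :=
  quarter_reverse (3 * u) (3 * taylor1 p u v) (taylor0 p q u v).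

Lemma coprime_den_taylor (p q u v : int) : coprimez u v ->
  [/\ coprimez v (taylor1 p u v), coprimez v (taylor0 p q u v)
    & coprimez v (taylorE p q u v)].
Proof.
rewrite coprimez_sym => vu; pose k := p * v; pose l := 3 * p * u * v + q * v ^+ 2.
have d1 : taylor1 p u v = u ^+ 2 + v * k by rewrite /taylor1 /k; ring.
have d0 : taylor0 p q u v = u ^+ 3 + v * l by rewrite /taylor0 /l; ring.
have dE : taylorE p q u v = u ^+ 6 + v *
    (81 * (3 * u ^+ 4 * k + 3 * u ^+ 2 * v * k ^+ 2 + v ^+ 2 * k ^+ 3)
     - 144 * u * (l * u ^+ 2 + k * u ^+ 3 + v * k * l) + 64 * (2 * u ^+ 3 * l + v * l ^+ 2)).
  by rewrite /taylorE d1 d0 /quarter_reverse; ring.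
by rewrite d1 d0 dE !coprimez_addl !coprimezXr.
Qed.

(** A common prime divisor of the value and of the derivative of X ^+ 3 + 3 * p * X + q
    at u / v divides its discriminant, hence v. *)
Lemma coprime_taylor1_taylor0 (p q u v : int) :
    coprimez u v -> (q ^+ 2 + 4 * p ^+ 3 %| v)%Z ->
  coprimez (taylor1 p u v) (taylor0 p q u v).
Proof.
move=> uv vD; have [v1 _ _] := coprime_den_taylor p q uv.
rewrite coprimez_sym in v1; set C1 := taylor1 p u v in v1 *.
have -> : taylor0 p q u v = v ^+ 2 * (2 * p * u + q * v) + C1 * u.
  by rewrite /C1 /taylor0 /taylor1; ring.
rewrite coprimez_addl coprimezMr coprimezXr //=.
suff : coprimez C1 ((2 * p * u + q * v) * (2 * p * u - q * v)).
  by rewrite coprimezMr => /andP[].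
rewrite (_ : _ * _ = - ((q ^+ 2 + 4 * p ^+ 3) * v ^+ 2) + C1 * (4 * p ^+ 2)); last first.
  by rewrite /C1 /taylor1; ring.
rewrite coprimez_addl coprimezN coprimezMr coprimezXr // andbT coprimez_sym.
by apply: coprimez_dvd vD _; rewrite coprimez_sym.
Qed.

Lemma coprime_taylorE (p q u v : int) :
    coprimez u v -> (6 %| v)%Z -> (q ^+ 2 + 4 * p ^+ 3 %| v)%Z ->
  coprimez (taylor1 p u v) (taylorE p q u v) /\
  coprimez (taylorE p q u v) (4 * taylor0 p q u v).
Proof.
move=> uv v6 vD; have [v1 v0 vE] := coprime_den_taylor p q uv.
have c10 := coprime_taylor1_taylor0 uv vD.
have v2 : (2 %| v)%Z by apply: dvdz_trans v6.
have v3 : (3 %| v)%Z by apply: dvdz_trans v6.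
set C1 := taylor1 p u v in v1 c10 *; set c0 := taylor0 p q u v in v0 c10 *.
split.
  have -> : taylorE p q u v = 2 ^+ 6 * c0 ^+ 2 + C1 * (81 * C1 ^+ 2 - 144 * u * c0).
    by rewrite /taylorE /quarter_reverse -/C1 -/c0; ring.
  rewrite coprimez_addl coprimezMr !coprimezXr // coprimez_sym.
  exact: coprimez_dvd v1.
rewrite coprimez_sym coprimezMl (_ : 4 = 2 ^+ 2) // coprimezXl ?(coprimez_dvd v2) //=.
have -> : taylorE p q u v = 3 ^+ 4 * C1 ^+ 3 + c0 * (64 * c0 - 144 * u * C1).
  by rewrite /taylorE /quarter_reverse -/C1 -/c0; ring.
rewrite coprimez_addl coprimezMr !coprimezXr //; first by rewrite coprimez_sym.
by rewrite coprimez_sym; apply: coprimez_dvd v0.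
Qed.

(** The hypothesis says that r is a root of the Taylor cubic modulo taylor1, so that
    1 / r is a root of the reversed cubic; modulo taylorE the reversed cubic has the root
    - 3 * taylor1 / (4 * taylor0) by definition of quarter_reverse. Modulo v the
    quadratic polynomial is congruent to u * (u * s + 1) * (u * s + 2), and a Newton step
    lifts the root s = - 1 / u to a root modulo v ^+ 2. *)
Lemma exists_residue (p q u v r b : int) :
  let C1 := taylor1 p u v in let c0 := taylor0 p q u v in
    coprimez u v -> (6 %| v)%Z -> (q ^+ 2 + 4 * p ^+ 3 %| v)%Z ->
    (C1 %| c0 + 3 * C1 * r + 3 * u * r ^+ 2 + r ^+ 3)%Z ->
  exists2 s : int,
    (C1 * taylorE p q u v %| c0 * s ^+ 3 + 3 * C1 * s ^+ 2 + 3 * u * s + 1)%Z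
    & (v ^+ 2 %| b * v + 2 * u + 3 * C1 * s + c0 * s ^+ 2)%Z.
Proof.
move=> C1 c0 uv v6 vD /dvdzP[x rP]; have [v1 v0 vE] := coprime_den_taylor p q uv.
have c10 := coprime_taylor1_taylor0 uv vD.
have [c1E cE0] := coprime_taylorE uv v6 vD.
rewrite -/C1 -/c0 in v1 v0 c10 c1E cE0; set Eh := taylorE p q u v in vE c1E cE0 *.
have rC1 : coprimez C1 r.
  have c0r : c0 = - (r * (3 * u * r + r ^+ 2)) + C1 * (x - 3 * r).
    by apply: (addIr (3 * C1 * r + 3 * u * r ^+ 2 + r ^+ 3)); rewrite !addrA rP; ring.
  by move: c10; rewrite c0r coprimez_addl coprimezN coprimezMr => /andP[].
have [|||||s [s1 s2 s3]] := @linear_congruences C1 Eh (v ^+ 2) r (4 * c0) (u ^+ 2)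
                  (- 1) (3 * C1) (u + v * b) c1E.
- by rewrite coprimezXr // coprimez_sym.
- by rewrite coprimezXr // coprimez_sym.
- exact: rC1.
- exact: cE0.
- by rewrite coprimezXl // coprimezXr // coprimez_sym.
exists s.
  rewrite Gauss_dvdz //; apply/andP; split.
    rewrite -(Gauss_dvdzr _ (coprimezXr 3 rC1)).
    rewrite (_ : _ * _ = c0 + 3 * C1 * r + 3 * u * r ^+ 2 + r ^+ 3 + (r * s - 1) *
       (c0 * ((r * s) ^+ 2 + r * s + 1) + 3 * C1 * r * (r * s + 1) + 3 * u * r ^+ 2)).
      by rewrite rP; apply: rpredD; [apply: dvdz_mull | apply: dvdz_mulr].
    by ring.
  have E64 : coprimez Eh (64 * c0 ^+ 2).
    move: cE0; rewrite coprimezMr => /andP[E4 Ec].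
    by rewrite coprimezMr (coprimezXr 2 Ec) andbT (_ : 64 = 4 ^+ 3) // coprimezXr.
  rewrite -(Gauss_dvdzr _ E64).
  rewrite (_ : _ * _ = Eh + (4 * c0 * s + 3 * C1) *
     ((4 * c0 * s) ^+ 2 + 9 * C1 * (4 * c0 * s) + 48 * c0 * u - 27 * C1 ^+ 2)).
    by rewrite rpredD ?dvdzz // dvdz_mulr.
  by rewrite /Eh /taylorE /quarter_reverse -/C1 -/c0; ring.
have v2u : coprimez (v ^+ 2) u by rewrite coprimezXl // coprimez_sym.
rewrite -(Gauss_dvdzr _ v2u).
pose y := u ^+ 2 * s + (u + v * b).
rewrite (_ : _ * _ = y * (y + u - 2 * v * b) +
   v ^+ 2 * (b ^+ 2 + 3 * p * u * s + (3 * p * u + q * v) * u * s ^+ 2)).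
  by rewrite rpredD // dvdz_mulr.
by rewrite /y /C1 /c0 /taylor1 /taylor0; ring.
Qed.

(** * The choice of the centre *)

Lemma Poly_eventually_gt0 (s : seq rat) : 0 < last 0 s ->
  exists T : rat, forall t, T <= t -> 0 < (Poly s).[t].
Proof.
move=> s_gt0; have [|d d_gt0 [T dP]] := @poly_eventually_ge (Poly s).
  by rewrite (Poly_size_lead _).2 ?gt_eqF.
by exists T => t /dP; apply: lt_le_trans.
Qed.

Lemma coprimez_reduce (x y : int) : 0 < y ->
  exists g u v : int, [/\ 0 < g, x = u * g, y = v * g & coprimez u v].
Proof.
move=> y_gt0; have g_gt0 : 0 < gcdz x y.
  by rewrite lt_neqAle eq_sym gcdz_eq0 negb_and (gt_eqF y_gt0) orbT.
exists (gcdz x y), (x %/ gcdz x y)%Z, (y %/ gcdz x y)%Z.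
rewrite !divzK ?dvdz_gcdl ?dvdz_gcdr //; split=> //.
apply/eqP/(mulIf (lt0r_neq0 g_gt0)).
rewrite -[X in _ * X](gtz0_abs g_gt0).
by rewrite mulz_gcdl !divzK ?dvdz_gcdl ?dvdz_gcdr // mul1r.
Qed.

(** Write f = X ^+ 3 + 3 * p * X + q, and let y = u / (M * v) be the centre and
    z = - w / M. The equation f (y + z) = f'(y) * (z + y / 3) says that y + z is a root of f
    modulo the derivative at y, and it is linear in y; it is the displayed relation
    between u and v. Here w is congruent to 1 modulo M and large, so that M survives in
    the denominator of y and y itself, close to w / (3 * M), is large. *)
Lemma exists_center (p q M : int) (Y : rat) : 0 < M ->
  exists u v w : int, [/\ 0 < v, coprimez u (M * v),
    u * (3 * w ^+ 2 + 2 * p * M ^+ 2) = v * (w ^+ 3 - q * M ^+ 3)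
    & Y * (M * v)%:~R <= u%:~R].
Proof.
move=> M_gt0; pose Mr : rat := M%:~R.
have [|T1 T1P] := @Poly_eventually_gt0 [:: 2 * p%:~R * Mr ^+ 2; 0; 3]; first by [].
have [|T2 T2P] := @Poly_eventually_gt0
  [:: - q%:~R * Mr ^+ 3 - 2 * Y * p%:~R * Mr ^+ 3; 0; - 3 * Y * Mr; 1]; first by [].
have [|k] := @int_progression_large 1 Mr (Num.max T1 T2); first by rewrite ltr0z.
rewrite ge_max => /andP[/T1P B_gt0 /T2P A_gt0].
pose w : int := 1 + M * k%:Z.
have wE : 1 + Mr * k%:R = w%:~R by rewrite /w intrD intrM.
have {}B_gt0 : 0 < 3 * w ^+ 2 + 2 * p * M ^+ 2.
  rewrite -(ltr0z rat); move: B_gt0; rewrite wE horner_Poly /=.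
  by rewrite !(intrD, intrM, rmorphXn) /= -/Mr; lra.
have [g [u [v [g_gt0 DA DB uv]]]] := coprimez_reduce (w ^+ 3 - q * M ^+ 3) B_gt0.
exists u, v, w; rewrite DA DB; split; [ | | by ring | ].
- by rewrite -(pmulr_lgt0 _ g_gt0) -DB.
- rewrite coprimezMr uv andbT; apply: (@coprimez_dvd _ (w ^+ 3 - q * M ^+ 3)).
    by rewrite DA dvdz_mulr.
  rewrite coprimez_sym (_ : _ - _ = w ^+ 3 + M * (- q * M ^+ 2)); last by ring.
  by rewrite coprimez_addl coprimezXr // coprimez_addl coprimezE coprimen1.
rewrite -(ler_pM2r (_ : 0 < g%:~R)) ?ltr0z // -intrM -DA intrM -!mulrA -intrM -DB.
move: A_gt0; rewrite wE horner_Poly /=.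
by rewrite !(intrB, intrD, intrM, rmorphXn) /= -/Mr; lra.
Qed.

Lemma center_positivity (p q : rat) : exists Y : rat, forall y, Y <= y ->
  [/\ 0 < y ^+ 2 + p, 0 < y ^+ 3 + 3 * p * y + q
   & 0 < quarter_reverse (3 * y) (3 * (y ^+ 2 + p)) (y ^+ 3 + 3 * p * y + q)].
Proof.
have [|T1 T1P] := @Poly_eventually_gt0 [:: p; 0; 1]; first by [].
have [|T2 T2P] := @Poly_eventually_gt0 [:: q; 3 * p; 0; 1]; first by [].
(* The coefficients, in y, of the third expression. *)
have [|T3 T3P] := @Poly_eventually_gt0
   [:: 81 * p ^+ 3 + 64 * q ^+ 2; 240 * p * q; 387 * p ^+ 2; - 16 * q; 51 * p; 0; 1]; first by [].
exists (Num.max T1 (Num.max T2 T3)) => y; rewrite !ge_max => /and3P[/T1P + /T2P + /T3P].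
rewrite !horner_Poly /= => y1 y2 y3; split; first by move: y1; lra.
  by move: y2; lra.
by move: y3; rewrite /quarter_reverse; lra.
Qed.

Lemma center_large_gt0 (p q : int) : exists Y : rat, forall u v : int,
  0 < v -> Y * v%:~R <= u%:~R ->
  [/\ 0 < taylor1 p u v, 0 < taylor0 p q u v & 0 < taylorE p q u v].
Proof.
have [Y YP] := center_positivity p%:~R q%:~R; exists Y => u v v_gt0 le_Y.
have vr_gt0 : 0 < v%:~R :> rat by rewrite ltr0z.
have vr_neq0 : v%:~R != 0 :> rat by rewrite gt_eqF.
pose y : rat := u%:~R / v%:~R.
have [|y1 y2 y3] := YP y; first by rewrite ler_pdivlMr.
rewrite -!(ltr0z rat).
have dE : (taylor1 p u v)%:~R = v%:~R ^+ 2 * (y ^+ 2 + p%:~R).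
  by rewrite /taylor1 /y; field.
have fE : (taylor0 p q u v)%:~R = v%:~R ^+ 3 * (y ^+ 3 + 3 * p%:~R * y + q%:~R).
  by rewrite /taylor0 /y; field.
have eE : (taylorE p q u v)%:~R = v%:~R ^+ 6 *
    quarter_reverse (3 * y) (3 * (y ^+ 2 + p%:~R)) (y ^+ 3 + 3 * p%:~R * y + q%:~R).
  by rewrite /taylorE /taylor0 /taylor1 /quarter_reverse /y; field.
by rewrite dE fE eE; split; apply: mulr_gt0 => //; apply: exprn_gt0.
Qed.

(** * Cubic polynomials *)

Lemma calP_opp (P : {poly int}) : calP (- P) -> calP P.
Proof. by move=> PN N; have [n ltNn] := PN N; rewrite hornerN dvdzE abszN; exists n. Qed.

Lemma horner_cubic (R : comNzRingType) (P : {poly R}) : size P = 4%N ->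
  forall x, P.[x] = P`_3 * x ^+ 3 + P`_2 * x ^+ 2 + P`_1 * x + P`_0.
Proof. by move=> szP x; rewrite horner_coef szP !big_ord_recl big_ord0 /= /bump /=; ring. Qed.

Lemma calP_double_root (P : {poly int}) (a b e : rat) : 0 < a ->
    (forall x, 27 * a ^+ 2 * (map_poly intr P).[x] =
       (3 * a * x + b - e) ^+ 2 * (3 * a * x + b + 2 * e)) ->
  calP P.
Proof.
move=> a_gt0 PE.
have lin z : size (Poly [:: z; 3 * a]) = 2%N /\ lead_coef (Poly [:: z; 3 * a]) = 3 * a.
  by apply: Poly_size_lead; rewrite /= gt_eqF // mulr_gt0.
pose l z : {poly rat} := Poly [:: z; 3 * a].
apply: (@calP_of_factorization P 'X [:: l (b - e); l (b - e); l (b + 2 * e)] (27 * a ^+ 2)^-1 0).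
- by rewrite invr_eq0 mulf_neq0 // expf_neq0 // gt_eqF.
- by rewrite size_polyX.
- by rewrite lead_coefX.
- have a3_gt0 : 0 < 3 * a by rewrite mulr_gt0.
  by move=> F; rewrite size_polyX !inE => /or3P[] /eqP->; rewrite !(lin _).1 (lin _).2.
- move=> t; apply: (@mulfI _ (27 * a ^+ 2)); first by rewrite mulf_neq0 // expf_neq0 // gt_eqF.
  rewrite hornerX PE !big_cons big_nil /l !horner_Poly /=.
  by field; rewrite gt_eqF.
- by rewrite hornerX rpred0.
Qed.

(** Here 3 * a * x + b is the variable in which 27 * a ^+ 2 * P becomes
    X ^+ 3 + 3 * p * X + q. The correction term of the splitting map has denominator
    C1 * Eh, up to primes that v takes care of, so that the divisibility of P.[n] makes
    its value the integer n - 192 * a * v ^+ 2 * c0 ^+ 2 * j. *)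
Lemma calP_of_center (P : {poly int}) (a b c d p q u v s n j : int) :
    (forall x : rat, (map_poly intr P).[x] =
       a%:~R * x ^+ 3 + b%:~R * x ^+ 2 + c%:~R * x + d%:~R) ->
    p = 3 * a * c - b ^+ 2 -> q = 2 * b ^+ 3 - 9 * a * b * c + 27 * a ^+ 2 * d ->
  let C1 := taylor1 p u v in let c0 := taylor0 p q u v in let Eh := taylorE p q u v in
    0 < a -> 0 < v -> 0 < C1 -> 0 < c0 -> 0 < Eh ->
    b * v + 2 * u + 3 * C1 * s + c0 * s ^+ 2 = - (3 * a * v * n) ->
    P.[n] = j * (C1 * Eh) ->
  calP P.
Proof.
move=> PE pE qE C1 c0 Eh a_gt0 v_gt0 C1_gt0 c0_gt0 Eh_gt0 nP jP.
have v_neq0 : v%:~R != 0 :> rat by rewrite intr_eq0 gt_eqF.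
have a_neq0 : a%:~R != 0 :> rat by rewrite intr_eq0 gt_eqF.
have C1_neq0 : C1%:~R != 0 :> rat by rewrite intr_eq0 gt_eqF.
have Eh_neq0 : Eh%:~R != 0 :> rat by rewrite intr_eq0 gt_eqF.
have EhE : quarter_reverse (3 * u%:~R) (3 * C1%:~R) c0%:~R = Eh%:~R :> rat.
  by rewrite /quarter_reverse /Eh /taylorE /quarter_reverse; ring.
have PE' (e : rat) :
    (map_poly intr P).[(3 * a%:~R * v%:~R)^-1 * e
                       + (u%:~R / v%:~R - b%:~R) / (3 * a%:~R)] =
    (27 * a%:~R ^+ 2 * v%:~R ^+ 3)^-1 * cubic (3 * u%:~R) (3 * C1%:~R) c0%:~R e.
  rewrite PE /cubic /C1 /c0 /taylor1 /taylor0 pE qE.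
  by field; rewrite a_neq0 v_neq0.
apply: (calP_of_cubic_point (s := s%:~R) _ _ _ _ _ PE').
- by rewrite invr_eq0 !mulf_neq0 ?expf_neq0.
- by rewrite invr_gt0 !mulr_gt0 ?ltr0z.
- by rewrite ltr0z.
- by rewrite mulr_gt0 ?ltr0z.
- by rewrite EhE ltr0z.
set e := - _.
have eE : e = v%:~R * (3 * a%:~R * n%:~R + b%:~R) - u%:~R.
  have n0 : (b * v + 2 * u + 3 * C1 * s + c0 * s ^+ 2 + 3 * a * v * n)%:~R = 0 :> rat.
    by rewrite nP addNr.
  by rewrite -[RHS]subr0 -n0 /e; ring.
have nE : (3 * a%:~R * v%:~R)^-1 * e + (u%:~R / v%:~R - b%:~R) / (3 * a%:~R) = n%:~R :> rat.
  by rewrite eE; field; rewrite a_neq0 v_neq0.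
have := PE' e; rewrite nE horner_map /= jP EhE => cubE.
have -> : cubic (3 * u%:~R) (3 * C1%:~R) c0%:~R e =
    27 * a%:~R ^+ 2 * v%:~R ^+ 3 * (j * (C1 * Eh))%:~R.
  by rewrite cubE mulVKf // !mulf_neq0 ?expf_neq0.
have -> : (3 * a%:~R * v%:~R)^-1 * (e - 64 * c0%:~R ^+ 2 *
     (27 * a%:~R ^+ 2 * v%:~R ^+ 3 * (j * (C1 * Eh))%:~R) / (3 * C1%:~R * Eh%:~R)) +
     (u%:~R / v%:~R - b%:~R) / (3 * a%:~R) = (n - 192 * a * v ^+ 2 * c0 ^+ 2 * j)%:~R.
  by rewrite eE; field; rewrite a_neq0 v_neq0 C1_neq0 Eh_neq0.
exact: intr_int.
Qed.

Lemma calP_separable (P : {poly int}) (a b c d p q : int) :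
    (forall x, P.[x] = a * x ^+ 3 + b * x ^+ 2 + c * x + d) ->
    (forall x : rat, (map_poly intr P).[x] =
       a%:~R * x ^+ 3 + b%:~R * x ^+ 2 + c%:~R * x + d%:~R) ->
    0 < a -> p = 3 * a * c - b ^+ 2 ->
    q = 2 * b ^+ 3 - 9 * a * b * c + 27 * a ^+ 2 * d ->
  q ^+ 2 + 4 * p ^+ 3 != 0 -> calP P.
Proof.
move=> PE PrE a_gt0 pE qE; set Delta := _ + _ => Delta_neq0.
(* The factors 6 and Delta make the moduli below coprime, and 3 * a makes n integral. *)
pose M := 6 * a * `|Delta|.
have M_gt0 : 0 < M by rewrite !mulr_gt0 ?normr_gt0.
have [Y YP] := center_large_gt0 p q.
have [u [v' [w [v'_gt0 uv center le_Y]]]] := exists_center p q Y M_gt0.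
have [v Dv] : exists v, v = M * v' by exists (M * v').
rewrite -Dv in uv le_Y.
have v_gt0 : 0 < v by rewrite Dv mulr_gt0.
have Mv : (M %| v)%Z by rewrite Dv dvdz_mulr.
have v6 : (6 %| v)%Z by apply: dvdz_trans Mv; rewrite /M -mulrA dvdz_mulr.
have vD : (Delta %| v)%Z by apply: dvdz_trans Mv; rewrite /M dvdz_mull // normrEsg dvdz_mull.
have [k Dk] : exists k, v = 3 * a * k.
  by exists (2 * `|Delta| * v'); rewrite Dv /M; ring.
have [C1_gt0 c0_gt0 Eh_gt0] := YP u v v_gt0 le_Y.
have [|s s1 s2] := @exists_residue p q u v (- (v' * w)) b uv v6 vD.
  apply/dvdzP; exists (3 * - (v' * w) + u); apply/eqP; rewrite -subr_eq0; apply/eqP.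
  move/eqP: center; rewrite -subr_eq0 => /eqP center.
  by rewrite -[RHS](mulr0 (v' ^+ 2)) -center Dv /taylor1 /taylor0; ring.
have [n nP] : exists n, b * v + 2 * u + 3 * taylor1 p u v * s + taylor0 p q u v * s ^+ 2 =
    - (3 * a * v * n).
  by case/dvdzP: s2 => x ->; exists (- (x * k)); rewrite [in LHS]expr2 {1}Dk; ring.
suff /dvdzP[j jP] : (taylor1 p u v * taylorE p q u v %| P.[n])%Z.
  exact: (calP_of_center PrE pE qE a_gt0 v_gt0 C1_gt0 c0_gt0 Eh_gt0 nP jP).
set C1 := taylor1 p u v in s1 nP *; set Eh := taylorE p q u v in s1 *.
set c0 := taylor0 p q u v in s1 nP.
pose e := - (c0 * s ^+ 2 + 3 * C1 * s + 3 * u).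
have De : u + e = v * (3 * a * n + b).
  apply/eqP; rewrite -subr_eq0; apply/eqP; move/eqP: nP; rewrite -subr_eq0 => /eqP nP.
  by rewrite -[RHS]oppr0 -nP /e; ring.
have vP : v ^+ 3 * (27 * a ^+ 2 * P.[n]) = e ^+ 3 + 3 * u * e ^+ 2 + 3 * C1 * e + c0.
  rewrite [RHS](_ : _ = (u + e) ^+ 3 + 3 * p * (u + e) * v ^+ 2 + q * v ^+ 3); last first.
    by rewrite /C1 /c0 /taylor1 /taylor0; ring.
  by rewrite De PE pE qE; ring.
have vCE : coprimez (C1 * Eh) v.
  have [v1 _ vE] := coprime_den_taylor p q uv.
  by rewrite coprimezMl ![coprimez _ v]coprimez_sym v1.
have a3CE : coprimez (C1 * Eh) (3 * a).
  by move: vCE; rewrite [in coprimez _ v]Dk coprimezMr => /andP[].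
have three : coprimez (C1 * Eh) 3 by move: a3CE; rewrite coprimezMr => /andP[].
rewrite -(Gauss_dvdzr _ (coprimezXr 2 a3CE)) -(Gauss_dvdzr _ three).
rewrite -(Gauss_dvdzr _ (coprimezXr 3 vCE)).
rewrite (_ : _ * (3 * _) = v ^+ 3 * (27 * a ^+ 2 * P.[n])); last by ring.
(* The reversed cubic at s divides the cubic at e. *)
rewrite vP (_ : _ + c0 = (c0 * s ^+ 3 + 3 * C1 * s ^+ 2 + 3 * u * s + 1) *
  (- c0 ^+ 2 * s ^+ 3 - 6 * c0 * C1 * s ^+ 2 - (9 * C1 ^+ 2 + 3 * c0 * u) * s
     + c0 - 9 * C1 * u)); last by rewrite /e; ring.
by rewrite dvdz_mulr.
Qed.

Lemma calP_cubic (P : {poly int}) : size P = 4%N -> calP P.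
Proof.
wlog a_gt0 : P / 0 < P`_3 => [hwlog szP|szP].
  have : P`_3 != 0 by have := lead_coef_eq0 P; rewrite lead_coefE szP -size_poly_eq0 szP => ->.
  case/lt_total/orP=> [a_lt0|a_gt0]; last exact: hwlog.
  by apply: calP_opp; apply: hwlog; rewrite ?coefN ?oppr_gt0 ?size_polyN.
have PE := horner_cubic szP.
have PrE : forall x : rat, (map_poly intr P).[x] =
    (P`_3)%:~R * x ^+ 3 + (P`_2)%:~R * x ^+ 2 + (P`_1)%:~R * x + (P`_0)%:~R.
  move=> x; rewrite horner_cubic ?coef_map //=.
  by rewrite size_map_inj_poly //; apply: intr_inj.
move: (P`_3) (P`_2) (P`_1) (P`_0) a_gt0 PE PrE => a b c d a_gt0 PE PrE.
pose p := 3 * a * c - b ^+ 2; pose q := 2 * b ^+ 3 - 9 * a * b * c + 27 * a ^+ 2 * d.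
have [Delta0|] := eqVneq (q ^+ 2 + 4 * p ^+ 3) 0; last exact: (calP_separable PE PrE).
have {}Delta0 : q%:~R ^+ 2 + 4 * p%:~R ^+ 3 = 0 :> rat.
  by move: p q Delta0 => {}p {}q Delta0; rewrite -[RHS]/(0%:~R) -Delta0; ring.
(* The cubic is then (X - e) ^+ 2 * (X + 2 * e). *)
have [e [pE qE]] : exists e : rat, p%:~R = - e ^+ 2 /\ q%:~R = 2 * e ^+ 3.
  move: (p%:~R : rat) (q%:~R : rat) Delta0 => {}p {}q Delta0.
  have [p0|p_neq0] := eqVneq p 0.
    exists 0; rewrite p0 !expr0n /= mulr0 oppr0; split=> //.
    by apply/eqP; rewrite -sqrf_eq0; apply/eqP; rewrite -[RHS]Delta0 p0 expr0n mulr0 addr0.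
  have q2 : q ^+ 2 = - 4 * p ^+ 3 by move: Delta0; lra.
  exists (- q / (2 * p)); split.
    by rewrite expr_div_n sqrrN q2; field.
  by rewrite expr_div_n [(- q) ^+ 3]exprS sqrrN q2; field.
have ar_gt0 : 0 < a%:~R :> rat by rewrite ltr0z.
apply: (@calP_double_root P a%:~R b%:~R e ar_gt0) => x; rewrite PrE.
rewrite [RHS](_ : _ = (3 * a%:~R * x + b%:~R) ^+ 3 + 3 * (- e ^+ 2) * (3 * a%:~R * x + b%:~R)
   + 2 * e ^+ 3); last by ring.
by rewrite -pE -qE /p /q; ring.
Qed.

Local Close Scope ring_scope.

Theorem theorem3p4 (P : {poly int}) (hP : size P = 4) : calP P.
Proof. exact: calP_cubic. Qed.
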